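(* Let $R$ be a discrete $\Gamma$-ring and $r\in R[2]$ a formal difference law in $R$. Then there is a unique multiplicative map (morphism of $\Gamma$-rings) $\phi:H\mathbb{Z}\to R$ with $\phi(\pm1_n)=r^n\in R[2^n]$ for all $n\ge0$; explicitly $\phi(n_1,\dots,n_k)=f(r^n)$ for any $n$ and any pointed map $f:[2^n]\to[k]$ with $f(\pm1_n)=(n_1,\dots,n_k)$.
   Context: Let $[n]=\{0,1,\dots,n\}$, pointed at $0$. A $\Gamma$-space is a functor $F$ from the finite pointed sets $[n]$ (with pointed maps) to pointed simplicial sets with $F[0]$ a point; for a pointed map $f$ we write $f$ also for $F(f)$; $\Sigma_n$ acts on $F[n]$ via permutations of $\{1,\dots,n\}$. We identify $[n]\wedge[m]$ with $[nm]$ via $i\wedge j\mapsto (j-1)n+i$. A $\Gamma$-ring is a $\Gamma$-space $R$ with unit $1\in R[1]$ (image of the unit map $\eta$) and associative unital multiplication given by natural maps $R(K)\wedge R(L)\to R(K\wedge L)$, $p\wedge q\mapsto pq$; it is discrete if all $R(K)$ are sets; $0\in R[1]$ denotes the basepoint. For $x\in R[2]$, $x^k\in R[2^k]$ is the $k$-fold product, $x^0=1$. A multiplicative map of $\Gamma$-rings is a natural transformation preserving units and products. Maps: $p^n_i:[n]\to[n-1]$, $p^n_i(j)=j$ ($j<i$), $p^n_i(i)=0$, $p^n_i(j)=j-1$ ($j>i$); for $1\le i<j\le n$ and $1\le k\le n-1$, $s^n_{i,j,k}:[n]\to[n-1]$ sends $0\mapsto0$, $i,j\mapsto k$, and the remaining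 elements order-preservingly and bijectively onto $\{1,\dots,n-1\}\setminus\{k\}$; $d^n_j:[n-1]\to[n]$ is the order-preserving injection missing $j$. $H\mathbb{Z}$ is the $\Gamma$-ring with $H\mathbb{Z}(K)$ the reduced free abelian group on $K$ (so $H\mathbb Z[k]=\mathbb Z^k$), pointed maps acting by summing coefficients along fibres, unit the inclusion of generators, multiplication $(\sum a_k k)(\sum b_l l)=\sum a_kb_l (k\wedge l)$. $\pm1_n=(1,-1)^n\in H\mathbb{Z}[2^n]$ (the $n$-th power of $(1,-1)\in H\mathbb Z[2]$). For $k\ge1$, split $\{1,\dots,2^k\}=A_+\sqcup A_-$ where $i\in A_+$ iff the binary expansion of $i-1$ has an even number of digits $1$. The special action of $\Sigma_{2^{k-1}}\times\Sigma_{2^{k-1}}$ on $F[2^k]$ is the action of the group of permutations of $\{1,\dots,2^k\}$ preserving $A_+$ and $A_-$. Let $\sigma$ be the nontrivial element of $\Sigma_2$. A formal difference law in $R$ is $r\in R[2]$ such that: (1) $p^2_2(r)=1$ and $s^2_{1,2,1}(r)=0$; (2) $p^2_1(r)\,r=r\,p^2_1(r)=\sigma(r)$ in $R[2]$; (3) for every $k\ge1$, $r^k$ is fixed under the special action; (4) for every $k\ge1$, all $1\le i<j\le 2^k$ with one of $i,j$ in $A_+$ and the other in $A_-$, and all $1\le l\le 2^k-1$: $s^{2^k}_{i,j,l}(r^k)=d^{2^k-1}_l\,p^{2^k-1}_i\,p^{2^k}_j(r^k)$. *)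

(* Defs.v *)
From HB Require Import structures.
From mathcomp Require Import all_boot all_order all_algebra all_fingroup.
Set Implicit Arguments. Unset Strict Implicit. Unset Printing Implicit Defensive.
Import GRing.Theory.

(* [n] is represented by 'I_n.+1, basepoint ord0. *)
Definition ptmap (n m : nat) := {f : {ffun 'I_n.+1 -> 'I_m.+1} | f ord0 == ord0}.

Definition pmv n m (f : ptmap n m) (l : nat) : nat := sval f (inord l).

(* build a pointed map from a nat function (0 is sent to 0; values are
   read through inord, only used with in-range values) *)
Definition mkpt_fun n m (g : nat -> nat) : {ffun 'I_n.+1 -> 'I_m.+1} :=
  [ffun i : 'I_n.+1 => if nat_of_ord i == 0%N then ord0 else inord (g i)].
Lemma mkpt_ok n m (g : nat -> nat) : mkpt_fun n m g ord0 == ord0.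
Proof. by rewrite /mkpt_fun ffunE eqxx. Qed.
Definition mkpt n m (g : nat -> nat) : ptmap n m := exist (fun f : {ffun 'I_n.+1 -> 'I_m.+1} => f ord0 == ord0) _ (mkpt_ok n m g).

Definition ptid n : ptmap n n := mkpt n n id.
Definition ptcomp n m k (g : ptmap m k) (f : ptmap n m) : ptmap n k :=
  mkpt n k (fun l => pmv g (pmv f l)).

(* smash of pointed maps, using [n]^[m] = [nm], i /\ j |-> (j-1)n+i *)
Definition ptsmash n n' m m' (f : ptmap n n') (g : ptmap m m')
  : ptmap (n * m) (n' * m') :=
  mkpt (n * m) (n' * m') (fun k =>
    let i := (k.-1 %% n).+1 in
    let j := (k.-1 %/ n).+1 in
    let fi := pmv f i in
    let gj := pmv g j in
    if (fi == 0%N) || (gj == 0%N) then 0%N else (gj.-1 * n' + fi)%N).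

Definition tcast (F : nat -> Type) (a b : nat) (e : a = b) (x : F a) : F b :=
  eq_rect a F x b e.

Record GRData := {
  car : nat -> Type;
  gr_pt : forall n, car n;
  gr_act : forall n m, ptmap n m -> car n -> car m;
  gr_one : car 1;
  gr_mul : forall n m, car n -> car m -> car (n * m)
}.
Arguments gr_pt {_} n.
Arguments gr_act {_ n m} f x.
Arguments gr_one {_}.
Arguments gr_mul {_ n m} x y.

Definition is_GammaRing (R : GRData) : Prop :=
  (forall n (x : car R n), gr_act (ptid n) x = x) /\
  (forall n m k (f : ptmap n m) (g : ptmap m k) (x : car R n),
      gr_act (ptcomp g f) x = gr_act g (gr_act f x)) /\
  (forall n m (f : ptmap n m), gr_act f (gr_pt n : car R n) = gr_pt m) /\
  (forall x : car R 0, x = gr_pt 0) /\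
  (* multiplication is defined on the smash product *)
  (forall n m (q : car R m), gr_mul (gr_pt n : car R n) q = gr_pt (n * m)) /\
  (forall n m (p : car R n), gr_mul p (gr_pt m : car R m) = gr_pt (n * m)) /\
  (forall n n' m m' (f : ptmap n n') (g : ptmap m m') (p : car R n) (q : car R m),
      gr_mul (gr_act f p) (gr_act g q) = gr_act (ptsmash f g) (gr_mul p q)) /\
  (forall n (p : car R n), @tcast (car R) _ _ (mul1n n) (gr_mul gr_one p) = p) /\
  (forall n (p : car R n), @tcast (car R) _ _ (muln1 n) (gr_mul p gr_one) = p) /\
  (forall n m k (p : car R n) (q : car R m) (s : car R k),
      @tcast (car R) _ _ (esym (mulnA n m k)) (gr_mul (gr_mul p q) s) = gr_mul p (gr_mul q s)).

Fixpoint pw (R : GRData) (x : car R 2) (k : nat) : car R (2 ^ k) :=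
  match k return car R (2 ^ k) with
  | 0 => gr_one
  | k'.+1 => @tcast (car R) _ _ (esym (expnSr 2 k')) (gr_mul (pw x k') x)
  end.

Definition is_mult (D E : GRData) (phi : forall n, car D n -> car E n) : Prop :=
  [/\ (forall n m (f : ptmap n m) (x : car D n), phi m (gr_act f x) = gr_act f (phi n x)),
      (forall n, phi n (gr_pt n) = gr_pt n),
      phi 1%N gr_one = gr_one &
      (forall n m (x : car D n) (y : car D m), phi (n * m)%N (gr_mul x y) = gr_mul (phi n x) (phi m y))].

(* HZ[n] = Z^n; coordinate i : 'I_n is the coefficient of the generator i+1 *)
Definition hz_act n m (f : ptmap n m) (a : n.-tuple int) : m.-tuple int :=
  [tuple (\sum_(i < n | nat_of_ord (sval f (lift ord0 i)) == j.+1) tnth a i)%R | j < m].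
Definition hz_mul n m (a : n.-tuple int) (b : m.-tuple int) : (n * m).-tuple int :=
  [tuple (nth 0 a (k %% n) * nth 0 b (k %/ n))%R | k < n * m].
Definition hz_pt n : n.-tuple int := [tuple 0%R | i < n].
Definition hz_one : 1.-tuple int := [tuple 1%R].

Definition HZ : GRData :=
  {| car := fun n => n.-tuple int; gr_pt := hz_pt; gr_act := hz_act;
     gr_one := hz_one; gr_mul := hz_mul |}.

Definition hz_pm : car HZ 2 := [tuple 1%R; (-1)%R].
Definition pm1 (n : nat) : car HZ (2 ^ n) := pw hz_pm n.

Definition pmap n i : ptmap n n.-1 :=
  mkpt n n.-1 (fun l => if l < i then l else if l == i then 0 else l.-1).
Definition smap n i j k : ptmap n n.-1 :=
  mkpt n n.-1 (fun l =>
    if l == 0 then 0 else if (l == i) || (l == j) then k else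
    let rk := (l - (i < l) - (j < l))%N in if rk < k then rk else rk.+1).
Definition dmap n j : ptmap n.-1 n :=
  mkpt n.-1 n (fun l => if l < j then l else l.+1).
Definition swap2 : ptmap 2 2 :=
  mkpt 2 2 (fun l => if l == 1 then 2 else if l == 2 then 1 else l).
Definition ptperm N (s : {perm 'I_N.+1}) : ptmap N N :=
  mkpt N N (fun l => nat_of_ord (s (inord l))).

Definition ones (x : nat) : nat := \sum_(b < x.+1) (odd (x %/ 2 ^ b) : nat).
(* element e >= 1 of {1..2^k} lies in A_+ iff inAp (e-1) *)
Definition inAp (x : nat) : bool := ~~ odd (ones x).

Definition fdl (R : GRData) (r : car R 2) : Prop :=
  [/\
      gr_act (pmap 2 2) r = gr_one /\ gr_act (smap 2 1 2 1) r = gr_pt 1,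
      @tcast (car R) _ _ (mul1n 2) (gr_mul (gr_act (pmap 2 1) r) r) = gr_act swap2 r /\
      @tcast (car R) _ _ (muln1 2) (gr_mul r (gr_act (pmap 2 1) r)) = gr_act swap2 r,
      (forall k, 0 < k -> forall s : {perm 'I_(2 ^ k).+1},
          s ord0 = ord0 ->
          (forall x : 'I_(2 ^ k).+1, x != ord0 -> inAp (s x).-1 = inAp x.-1) ->
          gr_act (ptperm s) (pw r k) = pw r k) &
      (forall k, 0 < k -> forall i j l,
          1 <= i -> i < j -> j <= 2 ^ k -> inAp i.-1 != inAp j.-1 ->
          1 <= l -> l <= (2 ^ k).-1 ->
          gr_act (smap (2 ^ k) i j l) (pw r k)
          = gr_act (dmap (2 ^ k).-1 l) (gr_act (pmap (2 ^ k).-1 i) (gr_act (pmap (2 ^ k) j) (pw r k))))].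

(* Main.v *)
(** For a fixed [n > 0], condition (4) lets one send to the basepoint any two
    elements of opposite sign with the same image under [f : [2^n] -> [k]]
    without changing [f(r^n)].  After all such cancellations each fibre of [f]
    over a non-base point has constant sign, so its size is read off from the
    coefficients of [f(±1_n)], and [f] is determined by these up to a
    sign-preserving permutation, which is absorbed by condition (3).  Hence
    [f(r^n)] depends only on [f(±1_n)].  Since [p^2_2(r) = 1], one and the same
    collapse [[2^(n+1)] -> [2^n]] carries [r^(n+1)] to [r^n] and [±1_(n+1)] to
    [±1_n], so the value does not depend on [n] either.  Every tuple is some
    [f(±1_n)], because the two halves of [±1_(n+1)] are [±1_n] and its negative,
    which makes the set of such tuples closed under subtraction. *)
Require Import Defs.
From HB Require Import structures.
From mathcomp Require Import all_boot all_order all_algebra all_fingroup.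
From mathcomp Require Import zify.
Set Implicit Arguments. Unset Strict Implicit. Unset Printing Implicit Defensive.
Import GRing.Theory.

(** * Pointed maps and their smash products as functions on numbers *)

Lemma pmv0 n m (f : ptmap n m) : pmv f 0 = 0.
Proof.
case: f => f /= f0; rewrite /pmv /=.
have -> : inord 0 = ord0 :> 'I_n.+1 by apply: val_inj; rewrite /= inordK.
by rewrite (eqP f0).
Qed.

Lemma pmv_le n m (f : ptmap n m) l : pmv f l <= m.
Proof. by rewrite -ltnS ltn_ord. Qed.

Lemma pmv_lift n m (f : ptmap n m) (i : 'I_n) : pmv f i.+1 = sval f (lift ord0 i).
Proof.
rewrite /pmv; congr (nat_of_ord (sval f _)).
by apply: val_inj; rewrite /= inordK // ltnS.
Qed.

Lemma pmv_mkpt n m g l :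
  0 < l -> l <= n -> g l <= m -> pmv (mkpt n m g) l = g l.
Proof.
move=> l0 ln gl; rewrite /pmv /= ffunE inordK ?ltnS //.
by rewrite -[l == 0](negbK _) -lt0n l0 /= inordK ?ltnS.
Qed.

Lemma pmv_id n l : l <= n -> pmv (ptid n) l = l.
Proof. by case: l => [|l] ln; rewrite ?pmv0 ?pmv_mkpt. Qed.

Lemma pmv_comp n m k (g : ptmap m k) (f : ptmap n m) l :
  l <= n -> pmv (ptcomp g f) l = pmv g (pmv f l).
Proof. by case: l => [|l] ln; rewrite ?pmv0 ?pmv_mkpt ?pmv_le. Qed.

Lemma ptmap_eq n m (f g : ptmap n m) :
  (forall l, 0 < l -> l <= n -> pmv f l = pmv g l) -> f = g.
Proof.
move=> fg; apply: val_inj; apply/ffunP => i; apply: val_inj => /=.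
have [i0|i0] := eqVneq (nat_of_ord i) 0.
  have -> : i = inord 0 by apply: val_inj; rewrite /= inordK.
  by have := pmv0 f; have := pmv0 g; rewrite /pmv => -> ->.
have := fg i; rewrite /pmv inord_val; apply; first by rewrite lt0n.
by rewrite -ltnS ltn_ord.
Qed.

Lemma pmv_smash n n' m m' (f : ptmap n n') (g : ptmap m m') t :
  t < n * m ->
  let u := pmv f (t %% n).+1 in let v := pmv g (t %/ n).+1 in
  pmv (ptsmash f g) t.+1 =
    if (u == 0) || (v == 0) then 0 else v.-1 * n' + u.
Proof.
move=> tnm u v; rewrite /ptsmash pmv_mkpt //= -/u -/v.
case: eqP => //= u0; case: eqP => //= v0.
have := pmv_le f (t %% n).+1; have := pmv_le g (t %/ n).+1.
rewrite -/u -/v; case: v v0 => // v _ /= vm un.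
rewrite -[n' * m']mulnC; apply: leq_trans (_ : v.+1 * n' <= _).
  by rewrite mulSn addnC leq_add2r.
by rewrite leq_mul2r vm orbT.
Qed.

(** Over a non-base point the fibre of a smash product is a product of fibres; naturality of the
    multiplication of [HZ] rests on this. *)
Lemma pmv_smash_eq n n' m m' (f : ptmap n n') (g : ptmap m m') t k :
  t < n * m ->
  (pmv (ptsmash f g) t.+1 == k.+1) =
  (pmv f (t %% n).+1 == (k %% n').+1) && (pmv g (t %/ n).+1 == (k %/ n').+1).
Proof.
move=> tnm; rewrite (pmv_smash f g tnm).
have := pmv_le f (t %% n).+1.
case: (pmv f _) => [|u] //= un; case: (pmv g _) => [|v] /=.
  by rewrite andbF.
rewrite !eqSS addnS eqSS; apply/eqP/andP => [<-|[/eqP -> /eqP ->]].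
  by rewrite modnMDl modn_small // divnMDl ?(leq_ltn_trans _ un) // divn_small // addn0 !eqxx.
by rewrite -divn_eq.
Qed.

Lemma nth_tcast (T : Type) (x0 : T) a b (e : a = b) (x : a.-tuple T) i :
  nth x0 (Defs.tcast (F := fun n => n.-tuple T) e x) i = nth x0 x i.
Proof. by case: b / e. Qed.

(** * The Γ-ring [HZ] *)

Section HZ.
Local Open Scope ring_scope.

Lemma tuple_nth_eq (T : Type) (x0 : T) n (a b : n.-tuple T) :
  (forall i, (i < n)%N -> nth x0 a i = nth x0 b i) -> a = b.
Proof. by move=> ab; apply: eq_from_tnth => i; rewrite !(tnth_nth x0) ab. Qed.

Lemma nth_hz_act n m (f : ptmap n m) (a : n.-tuple int) j : (j < m)%N ->
  nth 0 (hz_act f a) j = \sum_(i < n | pmv f i.+1 == j.+1) nth 0 a i.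
Proof.
move=> jm; rewrite -[j]/(nat_of_ord (Ordinal jm)) -tnth_nth tnth_mktuple /=.
by apply: eq_big => i; rewrite ?pmv_lift // => _; rewrite (tnth_nth 0).
Qed.

Lemma nth_hz_mul n m (a : n.-tuple int) (b : m.-tuple int) k : (k < n * m)%N ->
  nth 0 (hz_mul a b) k = nth 0 a (k %% n)%N * nth 0 b (k %/ n)%N.
Proof.
by move=> knm; rewrite -[k]/(nat_of_ord (Ordinal knm)) -tnth_nth tnth_mktuple.
Qed.

Lemma nth_hz_pt n i : nth 0 (hz_pt n) i = 0.
Proof.
have [ni|ni] := leqP n i; first by rewrite nth_default // size_tuple.
by rewrite -[i]/(nat_of_ord (Ordinal ni)) -tnth_nth tnth_mktuple.
Qed.

Lemma big_ord_mul n m (F : nat -> nat -> int) :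
  \sum_(t < n * m) F (t %% n)%N (t %/ n)%N = \sum_(j < m) \sum_(i < n) F i j.
Proof.
elim: m => [|m IH]; first by rewrite muln0 !big_ord0.
rewrite big_ord_recr /= -IH mulnSr big_split_ord /=; congr (_ + _).
apply: eq_bigr => i _; have n0 := leq_ltn_trans (leq0n _) (ltn_ord i).
by rewrite mulnC modnMDl modn_small // divnMDl // divn_small // addn0.
Qed.

(** Makes the general lemmas on powers and collapses available for [HZ], so that [hz_pm] and [r] can
    be treated in parallel. *)
Lemma HZ_GammaRing : is_GammaRing HZ.
Proof.
split=> [n a|]; last split=> [n m k f g a|]; last split=> [n m f|];
  last split=> [a|]; last split=> [n m q|]; last split=> [n m p|];
  last split=> [n n' m m' f g p q|]; last split=> [n p|];
  last split=> [n p|n m k p q s]; rewrite /=;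
  apply: (@tuple_nth_eq _ 0) => i ik.
- rewrite nth_hz_act // (big_pred1 (Ordinal ik)) // => j /=.
  by rewrite pmv_id ?eqSS.
- rewrite !nth_hz_act //.
  rewrite [RHS](eq_bigr (fun l : 'I_m =>
    \sum_(j < n | pmv f j.+1 == l.+1) nth 0 a j)); last first.
    by move=> l _; rewrite nth_hz_act.
  rewrite (exchange_big_dep predT) //= big_mkcond; apply: eq_bigr => j _.
  rewrite pmv_comp //.
  case E: (pmv f j.+1) (pmv_le f j.+1) => [|u] um.
    by rewrite pmv0 big_pred0 // => l; rewrite andbF.
  case: ifP => gu.
    rewrite (big_pred1 (Ordinal um)) // => l /=.
    rewrite eqSS -val_eqE /= [u == l]eq_sym.
    by case: (nat_of_ord l =P u) => [->|_]; rewrite ?gu ?andbF.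
  rewrite big_pred0 // => l; rewrite eqSS.
  by case: (u =P l) => [<-|_]; rewrite ?gu ?andbF.
- by rewrite nth_hz_act // nth_hz_pt big1 // => j _; rewrite nth_hz_pt.
- by [].
- by rewrite nth_hz_mul // !nth_hz_pt mul0r.
- by rewrite nth_hz_mul // !nth_hz_pt mulr0.
- have n'0 : (0 < n')%N by case: (n') ik.
  have i1 : (i %% n' < n')%N by rewrite ltn_mod.
  have i2 : (i %/ n' < m')%N by rewrite ltn_divLR // mulnC.
  rewrite nth_hz_mul // !nth_hz_act //.
  rewrite big_mkcond [X in _ * X]big_mkcond [RHS]big_mkcond /=.
  (* The summand depends on the smash index only through its remainder and quotient, so the sum
     splits into a double sum over the two factors. *)
  pose F u v := if (pmv f u.+1 == (i %% n').+1) && (pmv g v.+1 == (i %/ n').+1)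
     then nth 0 p u * nth 0 q v else 0.
  rewrite [RHS](eq_bigr (fun t : 'I_(n * m) => F (t %% n)%N (t %/ n)%N)).
    rewrite big_ord_mul mulr_sumr; apply: eq_bigr => v _.
    rewrite mulr_suml; apply: eq_bigr => u _; rewrite /F.
    by do 2!case: ifP => _; rewrite ?mul0r ?mulr0.
  by move=> t _; rewrite pmv_smash_eq // nth_hz_mul.
- rewrite nth_tcast nth_hz_mul ?mul1n // modn1 divn1 /= mul1r //.
- by rewrite nth_tcast nth_hz_mul ?muln1 // modn_small // divn_small //= mulr1.
- have h : (i < n * m * k)%N by rewrite -mulnA.
  have nm : (0 < n * m)%N by case: (n * m)%N h.
  have n0 : (0 < n)%N by case: (n) nm.
  rewrite nth_tcast !nth_hz_mul ?ltn_mod // ?ltn_divLR //; last by rewrite mulnC mulnA.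
  rewrite modn_dvdm ?dvdn_mulr // divnMA mulrA; congr (_ * _ * _).
  by rewrite modn_divl [(m * n)%N]mulnC.
Qed.
End HZ.

(** * Binary digits and the signs of ±1_n *)

Lemma ones_expn n x : x < 2 ^ n -> ones x = \sum_(b < n) odd (x %/ 2 ^ b).
Proof.
(* Both digit sums are padded with zero digits to the common length [maxn n x.+1]. *)
have small k y : y < 2 ^ k -> \sum_(b < k + (maxn n x.+1 - k)) (odd (y %/ 2 ^ b) : nat)
    = \sum_(b < k) odd (y %/ 2 ^ b).
  move=> yk; rewrite big_split_ord /= [X in _ + X]big1 ?addn0 // => i _.
  by rewrite divn_small // (leq_trans yk) // leq_exp2l // leq_addr.
move=> xn; rewrite /ones -(small n x xn) -(small x.+1 x).
  by rewrite !subnKC ?leq_maxl ?leq_maxr.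
by rewrite (leq_trans (ltn_expl x (ltnSn 1))) // leq_exp2l.
Qed.

Lemma inAp_recr n x : x < 2 ^ n.+1 ->
  inAp x = inAp (x %% 2 ^ n) (+) odd (x %/ 2 ^ n).
Proof.
move=> xn; rewrite /inAp (ones_expn xn) big_ord_recr /=.
rewrite (@ones_expn n (x %% 2 ^ n)) ?ltn_mod ?expn_gt0 //.
rewrite oddD oddb -addNb; congr (~~ odd _ (+) _); apply: eq_bigr => b _.
(* For [b < n] the part of [x] above [2 ^ n] is an even multiple of [2 ^ b], so it does not change
   digit [b]. *)
have e : x %/ 2 ^ n * 2 ^ n = x %/ 2 ^ n * 2 ^ (n - b) * 2 ^ b.
  by rewrite -mulnA -expnD subnK // ltnW.
rewrite {1}(divn_eq x (2 ^ n)) e divnMDl ?expn_gt0 // oddD oddM oddX.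
by rewrite subn_eq0 leqNgt ltn_ord andbF.
Qed.

(** The last factor (1,-1) is indexed by the top binary digit, so it changes the sign exactly when
    that digit changes the parity. *)
Lemma nth_pm1 n i : i < 2 ^ n ->
  nth 0%R (pm1 n) i = if inAp i then 1%R else (-1)%R.
Proof.
elim: n i => [|n IH] i /=.
  by rewrite expn0 ltnS leqn0 => /eqP ->; rewrite /inAp /ones big_ord1.
move=> iN; have iN2 : i < 2 ^ n * 2 by rewrite -expnSr.
rewrite /pm1 /= nth_tcast nth_hz_mul // IH ?ltn_mod ?expn_gt0 //.
rewrite (inAp_recr iN).
have : i %/ 2 ^ n < 2 by rewrite ltn_divLR ?expn_gt0 // mulnC.
by case: (_ %/ _) => [|[|]] //=; case: inAp.
Qed.

(** * Powers in a Γ-ring and collapses between them *)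

Section GammaRing.
Variables (R : GRData) (HR : is_GammaRing R).

Lemma gr_act_id n (x : car R n) : gr_act (ptid n) x = x.
Proof. by case: HR => + _; apply. Qed.

Lemma gr_act_comp n m k (f : ptmap n m) (g : ptmap m k) (x : car R n) :
  gr_act (ptcomp g f) x = gr_act g (gr_act f x).
Proof. by case: HR => _ [+ _]; apply. Qed.

Lemma gr_act_pt n m (f : ptmap n m) : gr_act f (gr_pt n : car R n) = gr_pt m.
Proof. by case: HR => _ [_ [+ _]]; apply. Qed.

Lemma gr_pt_unique (x : car R 0) : x = gr_pt 0.
Proof. by case: HR => _ [_ [_ [+ _]]]; apply. Qed.

Lemma gr_mul_act n n' m m' (f : ptmap n n') (g : ptmap m m') (p : car R n) (q : car R m) :
  gr_mul (gr_act f p) (gr_act g q) = gr_act (ptsmash f g) (gr_mul p q).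
Proof. by case: HR => _ [_ [_ [_ [_ [_ [+ _]]]]]]; apply. Qed.

Lemma gr_mulr1 n (p : car R n) : Defs.tcast (muln1 n) (gr_mul p gr_one) = p.
Proof. by case: HR => _ [_ [_ [_ [_ [_ [_ [_ [+ _]]]]]]]]; apply. Qed.

Lemma gr_mulA n m k (p : car R n) (q : car R m) (s : car R k) :
  Defs.tcast (esym (mulnA n m k)) (gr_mul (gr_mul p q) s) = gr_mul p (gr_mul q s).
Proof. by case: HR => _ [_ [_ [_ [_ [_ [_ [_ [_ ]]]]]]]]; apply. Qed.

(** Turns a transport into the action of a pointed map, which can then be composed with others. *)
Lemma tcast_act a b (e : a = b) (x : car R a) :
  Defs.tcast e x = gr_act (mkpt a b id) x.
Proof. by case: b / e; rewrite -/(ptid a) gr_act_id. Qed.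

Lemma Tagged_tcast a b (e : a = b) (x : car R a) :
  Tagged (car R) (Defs.tcast e x) = Tagged (car R) x.
Proof. by case: b / e. Qed.

(** In the total space of [car R] transports along equalities of indices disappear, so the unit and
    associativity laws become plain equations. *)
Let smul (p q : {n & car R n}) := Tagged (car R) (gr_mul (tagged p) (tagged q)).

Lemma pw_add (x : car R 2) n m :
  gr_mul (pw x n) (pw x m) = gr_act (mkpt (2 ^ (n + m)) (2 ^ n * 2 ^ m) id) (pw x (n + m)).
Proof.
rewrite -(tcast_act (expnD 2 n m)); apply: eq_from_Tagged.
rewrite Tagged_tcast.
have pwS k : Tagged (car R) (pw x k.+1) = smul (Tagged (car R) (pw x k)) (Tagged (car R) x).
  by rewrite /= Tagged_tcast.
rewrite -[LHS]/(smul (Tagged (car R) (pw x n)) (Tagged (car R) (pw x m))).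
elim: m => [|m IH].
  by rewrite addn0 /smul /= -(Tagged_tcast (muln1 _)) gr_mulr1.
rewrite addnS !pwS -IH /smul /=.
by rewrite -[in RHS](Tagged_tcast (esym (mulnA _ _ _))) gr_mulA.
Qed.

Lemma pwS (x : car R 2) n :
  gr_mul (pw x n) x = gr_act (mkpt (2 ^ n.+1) (2 ^ n * 2) id) (pw x n.+1).
Proof.
rewrite -(tcast_act (expnSr 2 n)) /=.
by move: (expnSr 2 n) => e; apply: eq_from_Tagged; rewrite !Tagged_tcast.
Qed.

(** The zero map factors through [0], where there is only one element. *)
Lemma gr_act_zero n m (x : car R n) : gr_act (mkpt n m (fun=> 0)) x = gr_pt m.
Proof.
have -> : mkpt n m (fun=> 0) = ptcomp (mkpt 0 m id) (mkpt n 0 (fun=> 0)).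
  by apply: ptmap_eq => l l0 ln; rewrite pmv_comp // pmv_mkpt // [pmv (mkpt n 0 _) l]pmv_mkpt // pmv0.
by rewrite gr_act_comp (gr_pt_unique (gr_act _ x)) gr_act_pt.
Qed.

End GammaRing.

(** The collapse is chosen before the Γ-ring, so that the same one serves [HZ] and [R]. *)
Lemma pw_lower n N : n <= N ->
  exists c : ptmap (2 ^ N) (2 ^ n), forall R, is_GammaRing R ->
    forall x : car R 2, gr_act (Defs.pmap 2 2) x = gr_one ->
    gr_act c (pw x N) = pw x n.
Proof.
elim: N => [|N IH].
  by rewrite leqn0 => /eqP ->; exists (ptid _) => R HR x _; rewrite gr_act_id.
rewrite leq_eqVlt => /orP[/eqP -> | /IH [c Hc]].
  by exists (ptid _) => R HR x _; rewrite gr_act_id.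
(* The last smash factor is collapsed by p^2_2, which turns it into the unit; the two maps built
   from [id] only relabel along [2 ^ N.+1 = 2 ^ N * 2] and [2 ^ N * 1 = 2 ^ N]. *)
exists (ptcomp c (ptcomp (mkpt (2 ^ N * 1) (2 ^ N) id)
  (ptcomp (ptsmash (ptid (2 ^ N)) (Defs.pmap 2 2)) (mkpt (2 ^ N.+1) (2 ^ N * 2) id)))).
move=> R HR x px; rewrite !gr_act_comp // -[RHS](Hc R HR x px); congr (gr_act c _).
rewrite -pwS // -gr_mul_act // px gr_act_id //.
by rewrite -(tcast_act HR (muln1 _)) gr_mulr1.
Qed.

(** * Cancelling a pair of elements *)

Definition erase N k (f : ptmap N k) (i j : nat) : ptmap N k :=
  mkpt N k (fun l => if (l == i) || (l == j) then 0 else pmv f l).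

Lemma pmv_erase N k (f : ptmap N k) i j l : 0 < l -> l <= N ->
  pmv (erase f i j) l = if (l == i) || (l == j) then 0 else pmv f l.
Proof. by move=> l0 lN; rewrite pmv_mkpt //; case: ifP => // _; apply: pmv_le. Qed.

(** The two composites are [f'] after the two sides of condition (4), so applying [f'] to that
    condition replaces [f] by [erase f i j]. *)
Lemma erase_factor N k (f : ptmap N k) i j :
  0 < i -> i < j -> j <= N -> pmv f i = pmv f j ->
  exists f' : ptmap N.-1 k,
    f = ptcomp f' (smap N i j 1) /\
    erase f i j =
      ptcomp f' (ptcomp (dmap N.-1 1) (ptcomp (Defs.pmap N.-1 i) (Defs.pmap N j))).
Proof.
move=> i0 ij jN fij.
(* Inverse of the order-preserving numbering, from 1, of the elements other than [i] and [j]. As the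
   merged pair occupies 1, the element of rank [q] sits at [q.+1], whence the [t.-1] in [f']. *)
pose unrank q := if q < i then q else if q.+1 < j then q.+1 else q.+2.
pose f' := mkpt N.-1 k (fun t => if t == 1 then pmv f i else pmv f (unrank t.-1)).
have f'E t : 0 < t -> t <= N.-1 ->
    pmv f' t = if t == 1 then pmv f i else pmv f (unrank t.-1).
  by move=> t0 tN; rewrite pmv_mkpt //; case: ifP => _; apply: pmv_le.
exists f'.
have unrankK l : 0 < l -> l != i -> l != j -> unrank (l - (i < l) - (j < l)) = l.
  by rewrite /unrank; do 2?case: ifP; lia.
split; apply: ptmap_eq => l l0 lN.
  rewrite pmv_comp // [pmv (smap _ _ _ _) l]pmv_mkpt //; last by rewrite /=; do !case: ifP; lia.
  have -> : (l == 0) = false by lia.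
  case: ifP => [lij|lij].
    by rewrite f'E //=; [case/orP: lij => /eqP -> | lia].
  have {lij} [li lj] : l != i /\ l != j by lia.
  rewrite /=.
  have -> : (l - (i < l) - (j < l) < 1) = false by lia.
  rewrite f'E //; last by lia.
  by rewrite -[_ == 1](_ : false = _) /= ?unrankK //; lia.
rewrite pmv_erase // !pmv_comp ?pmv_le //.
have [->|lj] := eqVneq l j.
  rewrite orbT [pmv (Defs.pmap N j) j]pmv_mkpt ?ltnn ?eqxx ?pmv0 //; lia.
have Epj : pmv (Defs.pmap N j) l = l - (j < l).
  by rewrite pmv_mkpt //; do ?case: ifP; lia.
rewrite Epj orbF; have [->|li] := eqVneq l i.
  (* Since [i < j], deleting [j] first leaves the label of [i] unchanged. *)
  rewrite -[i - _](_ : i = _); last by lia.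
  rewrite [pmv (Defs.pmap N.-1 i) i]pmv_mkpt ?ltnn ?eqxx ?pmv0 //; lia.
rewrite [pmv (Defs.pmap N.-1 i) _]pmv_mkpt; [|lia|lia|by do ?case: ifP; lia].
rewrite -[if _ then _ else _](_ : l - (i < l) - (j < l) = _); last first.
  by do ?case: ifP; lia.
rewrite [pmv (dmap N.-1 1) _]pmv_mkpt; [|lia|lia|by case: ifP; lia].
have -> : (l - (i < l) - (j < l) < 1) = false by lia.
rewrite f'E //; last by lia.
by rewrite -[_ == 1](_ : false = _) /= ?unrankK //; lia.
Qed.

(** * An element with sign symmetry and pair cancellation is seen by [f] only through its weights *)

Section SignedElement.
Local Open Scope ring_scope.
Variables (R : GRData) (HR : is_GammaRing R) (N : nat) (c : nat -> bool) (x : car R N).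
Hypothesis x_perm : forall s : {perm 'I_N.+1}, s ord0 = ord0 ->
  (forall y, y != ord0 -> c (s y).-1 = c y.-1) -> gr_act (ptperm s) x = x.
Hypothesis x_pair : forall i j, (0 < i)%N -> (i < j)%N -> (j <= N)%N ->
  c i.-1 != c j.-1 ->
  gr_act (smap N i j 1) x =
    gr_act (dmap N.-1 1) (gr_act (Defs.pmap N.-1 i) (gr_act (Defs.pmap N j) x)).

(* Generators are numbered from 0 here: [c i] is the sign of the element [i.+1]
   of [N], and [weight f l] is the coefficient of [l.+1] in [f(±1_n)]. *)
Definition sgn i : int := if c i then 1 else -1.
Definition weight k (f : ptmap N k) (l : nat) : int :=
  \sum_(i < N | pmv f i.+1 == l.+1) sgn i.
Definition reduced k (f : ptmap N k) :=
  [forall i : 'I_N, forall j : 'I_N,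
    (pmv f i.+1 == pmv f j.+1) && (pmv f i.+1 != 0%N) ==> (c i == c j)].
Definition fiber_card k (f : ptmap N k) (s : bool) (l : nat) :=
  #|[pred i : 'I_N | (pmv f i.+1 == l) && (c i == s)]|.

Lemma act_erase k (f : ptmap N k) i j :
  (0 < i)%N -> (i < j)%N -> (j <= N)%N -> c i.-1 != c j.-1 -> pmv f i = pmv f j ->
  gr_act f x = gr_act (erase f i j) x.
Proof.
move=> i0 ij jN cij fij; have [f' [-> ->]] := erase_factor i0 ij jN fij.
by rewrite !gr_act_comp // x_pair.
Qed.

(** The erased elements lie in one fibre with opposite signs, so their contributions to the sum add
    up to zero. *)
Lemma weight_erase k (f : ptmap N k) (i j : 'I_N) l :
  c i != c j -> pmv f i.+1 = pmv f j.+1 ->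
  weight (erase f i.+1 j.+1) l = weight f l.
Proof.
move=> cij fij; rewrite /weight.
have nij : j != i by apply: contraNneq cij => ->.
rewrite (eq_bigl (fun t : 'I_N => [&& pmv f t.+1 == l.+1, t != i & t != j])); last first.
  move=> t; rewrite pmv_erase ?ltn_ord // !eqSS !val_eqE.
  by case: (eqVneq t i) => _; case: (eqVneq t j) => _; rewrite /= ?andbF ?andbT.
have [fil|fil] := eqVneq (pmv f i.+1) l.+1.
  rewrite [RHS](bigD1 i) ?fil //= [X in _ = _ + X](bigD1 j) /= -?fij ?fil ?eqxx ?nij //= addrA.
  rewrite (_ : sgn i + sgn j = 0) ?add0r; last first.
    by move: cij; rewrite /sgn; do 2!case: (c _).
  by apply: eq_bigl => t; rewrite andbA.
apply: eq_bigl => t; have [->|] := eqVneq t i.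
  by rewrite andbF (negPf fil).
have [->|] := eqVneq t j; first by rewrite -fij (negPf fil).
by rewrite !andbT.
Qed.

Lemma exists_reduced k (f : ptmap N k) :
  exists2 f' : ptmap N k, reduced f' &
    gr_act f x = gr_act f' x /\ weight f =1 weight f'.
Proof.
(* Each cancellation lowers the number of elements not sent to the basepoint. *)
have [n] := ubnP #|[pred i : 'I_N | pmv f i.+1 != 0%N]|.
elim: n f => // n IH f; rewrite ltnS => fn.
have [rf|] := boolP (reduced f); first by exists f.
rewrite negb_forall => /existsP[i0]; rewrite negb_forall => /existsP[j0].
rewrite negb_imply -andbA => /and3P[/eqP fij0 fi0 cij0].
have [i [j [ij cij fij fi]]] : exists i j : 'I_N,
  [/\ (i < j)%N, c i != c j, pmv f i.+1 = pmv f j.+1 & pmv f i.+1 != 0%N].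
  have [ij|ji|/val_inj ij] := ltngtP i0 j0.
  - by exists i0, j0.
  - by exists j0, i0; rewrite eq_sym -fij0.
  - by rewrite ij eqxx in cij0.
have [|f' rf' [ff' wf']] := IH (erase f i.+1 j.+1).
  apply: leq_trans fn; apply: proper_card; apply/properP; split.
    apply/subsetP => t; rewrite !inE pmv_erase //.
    by case: ifP.
  by exists i; rewrite !inE // pmv_erase // eqxx.
exists f' => //; split=> [|l]; last by rewrite -wf' weight_erase.
by rewrite -ff'; apply: act_erase.
Qed.

Lemma weight_card k (f : ptmap N k) l :
  weight f l = (fiber_card f true l.+1)%:Z - (fiber_card f false l.+1)%:Z.
Proof.
rewrite /weight (bigID (fun i : 'I_N => c i)) /=; congr (_ + _).
  rewrite (eq_bigr (fun=> 1)) => [|i /andP[_ ci]]; last by rewrite /sgn ci.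
  by rewrite sumr_const natz; congr (_%:Z); apply: eq_card => i; rewrite !inE eqb_id.
rewrite (eq_bigr (fun=> - 1)) => [|i /andP[_ /negPf ci]]; last by rewrite /sgn ci.
rewrite sumrN sumr_const natz; congr (- _%:Z).
by apply: eq_card => i; rewrite !inE eqbF_neg.
Qed.

Lemma fiber_card_reduced k (f : ptmap N k) l : reduced f ->
  (fiber_card f true l.+1 == 0%N) || (fiber_card f false l.+1 == 0%N).
Proof.
move=> /forallP rf; rewrite -[_ || _]negbK negb_or -!lt0n.
apply/negP => /andP[/card_gt0P[i] + /card_gt0P[j]].
rewrite !inE => /andP[/eqP fi /eqP ci] /andP[/eqP fj /eqP cj].
by have /forallP/(_ j) := rf i; rewrite fi fj eqxx ci cj.
Qed.

(** Recovers the fibre over the basepoint, which the weights do not record, from the other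
    fibres. *)
Lemma fiber_card_sum k (f : ptmap N k) s :
  (fiber_card f s 0 + \sum_(l < k) fiber_card f s l.+1)%N
  = #|[pred i : 'I_N | c i == s]|.
Proof.
rewrite -[RHS]sum1_card (partition_big (fun i : 'I_N => inord (pmv f i.+1) : 'I_k.+1) predT) //.
have E (l : 'I_k.+1) : (\sum_(i : 'I_N | (i \in [pred i : 'I_N | c i == s]) &&
    (inord (pmv f i.+1) == l)) 1)%N = fiber_card f s l.
  rewrite sum1_card; apply: eq_card => i; rewrite !inE andbC; congr (_ && _).
  by rewrite -val_eqE /= inordK // ltnS pmv_le.
by rewrite big_ord_recl E; congr (_ + _)%N; apply: eq_bigr => l _; rewrite E.
Qed.

(** Equal counts make the lists of pairs (value, sign) of [f] and [g] rearrangements of each other.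
    The rearrangement preserves signs, so [f] is [g] after a permutation that fixes [x]. *)
Lemma act_eq_fiber_card k (f g : ptmap N k) :
  (forall s l, fiber_card f s l = fiber_card g s l) -> gr_act f x = gr_act g x.
Proof.
move=> fg.
pose lbl (h : ptmap N k) := [tuple (pmv h i.+1, c i) | i < N].
have : perm_eq (lbl f) (lbl g).
  apply/allP => -[l s] _ /=; apply/eqP.
  have E (h : ptmap N k) : count_mem (l, s) (lbl h) = fiber_card h s l.
    rewrite count_map val_ord_tuple enumT /fiber_card cardE /enum_mem size_filter.
    by apply: eq_count => i; rewrite /= !inE xpair_eqE.
  by have := E f; have := E g; rewrite /= => -> ->.
case/tuple_permP => p fgp.
have {fgp} fgp (i : 'I_N) : pmv f i.+1 = pmv g (p i).+1 /\ c i = c (p i).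
  have := congr1 (fun s => nth (0%N, true) s i) fgp.
  rewrite -!tnth_nth !tnth_mktuple => -[-> ->] //.
pose s := lift_perm ord0 ord0 p.
have -> : f = ptcomp g (ptperm s).
  apply: ptmap_eq => -[|l] // _ lN; rewrite pmv_comp //.
  have := fgp (Ordinal lN) => /= -[-> _].
  have -> : pmv (ptperm s) l.+1 = (p (Ordinal lN)).+1; last by [].
  have e : inord l.+1 = lift ord0 (Ordinal lN) by apply: val_inj; rewrite /= inordK.
  by rewrite pmv_mkpt // e lift_perm_lift //= ltn_ord.
rewrite gr_act_comp // x_perm //; first by rewrite lift_perm_id.
move=> y; case: (unliftP ord0 y) => [i ->|->] // _.
by rewrite lift_perm_lift /=; have [_ ->] := fgp i.
Qed.

Lemma act_eq_weight k (f g : ptmap N k) :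
  (forall l, (l < k)%N -> weight f l = weight g l) -> gr_act f x = gr_act g x.
Proof.
move=> fg; have [f' rf [-> wf]] := exists_reduced f.
have [g' rg [-> wg]] := exists_reduced g.
have {wf wg} {}fg l : (l < k)%N -> weight f' l = weight g' l.
  by move=> lk; rewrite -wf -wg fg.
(* The weight is a difference of two counts, one of which vanishes for a reduced map, so it
   determines both. *)
have fgS s l : (l < k)%N -> fiber_card f' s l.+1 = fiber_card g' s l.+1.
  move=> /fg; rewrite !weight_card.
  have := fiber_card_reduced l rf; have := fiber_card_reduced l rg.
  by case: s; lia.
apply: act_eq_fiber_card => s [|l].
  have := fiber_card_sum f' s; rewrite -(fiber_card_sum g' s).
  by under eq_bigr => l _ do rewrite fgS //; move/addIn.
have [/fgS //|kl] := ltnP l k.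
by rewrite /fiber_card !eq_card0 // => i; rewrite inE;
  apply/negP => /andP[/eqP e _]; have := kl; rewrite leqNgt -e pmv_le.
Qed.

End SignedElement.

(** * Every integer tuple is some f(±1_n) *)

Lemma hz_act_comp n m k (f : ptmap n m) (g : ptmap m k) (a : n.-tuple int) :
  hz_act (ptcomp g f) a = hz_act g (hz_act f a).
Proof. exact: (gr_act_comp HZ_GammaRing). Qed.

Lemma hz_pm_collapse : gr_act (Defs.pmap 2 2) hz_pm = gr_one.
Proof.
apply: (@tuple_nth_eq _ 0%R) => i; rewrite ltnS leqn0 => /eqP ->.
rewrite (nth_hz_act (Defs.pmap 2 2) hz_pm (ltn0Sn 0)).
rewrite big_mkcond !big_ord_recl big_ord0 /=.
by rewrite !pmv_mkpt.
Qed.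

Section Reach.
Local Open Scope ring_scope.

(** Row vectors replace tuples here for their module structure over the integers and their standard
    basis. *)
Let reached k (v : 'rV[int]_k) := exists n (f : ptmap (2 ^ n) k),
  forall j : 'I_k, nth 0 (hz_act f (pm1 n)) j = v 0 j.

Let reached_sub k (v w : 'rV[int]_k) : reached v -> reached w -> reached (v - w).
Proof.
move=> [n [f fv]] [m [g gw]].
have [cn Hn] := pw_lower (leq_maxl n m); have [cm Hm] := pw_lower (leq_maxr n m).
have {Hn} Hn := Hn HZ HZ_GammaRing hz_pm hz_pm_collapse.
have {Hm} Hm := Hm HZ HZ_GammaRing hz_pm hz_pm_collapse.
move: (maxn n m) cn cm Hn Hm => N cn cm Hn Hm.
(* With both vectors presented at the same exponent, [f] acts on the first half of the elements and
   [g] on the second. *)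
pose h := mkpt (2 ^ N.+1) k (fun l =>
  if (l <= 2 ^ N)%N then pmv (ptcomp f cn) l else pmv (ptcomp g cm) (l - 2 ^ N)).
exists N.+1, h => j; rewrite !mxE -fv -gw -[pm1 n]Hn -[pm1 m]Hm.
rewrite -[gr_act cn _]/(hz_act cn (pm1 N)) -[gr_act cm _]/(hz_act cm (pm1 N)).
rewrite -!hz_act_comp !nth_hz_act //.
have Eh i : (i < 2 ^ N.+1)%N -> pmv h i.+1 =
    if (i < 2 ^ N)%N then pmv (ptcomp f cn) i.+1 else pmv (ptcomp g cm) (i.+1 - 2 ^ N).
  by move=> iN; rewrite pmv_mkpt //; case: ifP => _; apply: pmv_le.
pose F i : int := if inAp i then 1 else -1.
rewrite (eq_bigr (fun i : 'I_ _ => F i)) => [|i _]; last by rewrite nth_pm1.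
rewrite [X in X - _](eq_bigr (fun i : 'I_ _ => F i)) => [|i _]; last by rewrite nth_pm1.
rewrite [X in _ - X](eq_bigr (fun i : 'I_ _ => F i)) => [|i _]; last by rewrite nth_pm1.
have e2 : (2 ^ N.+1 = 2 ^ N + 2 ^ N)%N by rewrite expnS mul2n addnn.
rewrite (eq_bigl (fun i : 'I_ _ => (if (i < 2 ^ N)%N then pmv (ptcomp f cn) i.+1
  else pmv (ptcomp g cm) (i.+1 - 2 ^ N)) == j.+1)) => [|i]; last by rewrite Eh.
(* Passing through a sum over natural numbers lets the bound [2 ^ N.+1] be rewritten as
   [2 ^ N + 2 ^ N] and the sum be split. *)
rewrite -(big_mkord (fun i => (if (i < 2 ^ N)%N then pmv (ptcomp f cn) i.+1
  else pmv (ptcomp g cm) (i.+1 - 2 ^ N)) == j.+1) F) [in LHS]e2 big_mkord.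
rewrite big_split_ord /=; congr (_ + _).
  by apply: eq_bigl => i; rewrite ltn_ord.
rewrite -sumrN; apply: eq_big => i.
  by rewrite ltnNge leq_addr /= -addnS addKn.
(* In the second half the top digit is 1, which reverses the sign. *)
move=> _; rewrite /F (@inAp_recr N) ?e2 ?ltn_add2l //.
rewrite -{1 4}[(2 ^ N)%N]mul1n modnMDl divnMDl ?expn_gt0 // modn_small // divn_small //.
by case: inAp.
Qed.

Lemma pm1_reach k (a : k.-tuple int) :
  exists n (f : ptmap (2 ^ n) k), hz_act f (pm1 n) = a.
Proof.
have r0 : reached (0 : 'rV[int]_k).
  exists 0%N, (mkpt 1 k (fun=> 0%N)) => j.
  by rewrite mxE nth_hz_act // big_pred0 // => i; rewrite pmv_mkpt.
have rD (v w : 'rV[int]_k) : reached v -> reached w -> reached (v + w).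
  by move=> rv rw; rewrite -[w]opprK -[- w]sub0r; do ![apply: reached_sub => //].
(* Exponent 0 suffices: ±1_0 is the unit, and its only generator is sent to [j.+1]. *)
have r1 (j : 'I_k) : reached (delta_mx 0 j).
  exists 0%N, (mkpt 1 k (fun=> j.+1)) => l.
  rewrite mxE eqxx nth_hz_act // big_mkcond big_ord1 pmv_mkpt //= eqSS eq_sym.
  by rewrite val_eqE; case: eqP.
have rZ (z : int) (v : 'rV[int]_k) : reached v -> reached (z *: v).
  move=> rv; rewrite -[z]intz scaler_int.
  have rN n : reached (v *+ n) by elim: n => // n IH; rewrite mulrS; apply: rD.
  case: z => n; first exact: rN.
  by rewrite NegzE mulrNz -sub0r; apply: reached_sub => //; apply: rN.
have [n [f fa]] : reached (\row_j tnth a j).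
  rewrite [\row_j _]row_sum_delta; apply: big_ind => // j _; apply: rZ.
  exact: r1.
exists n, f; apply: (@tuple_nth_eq _ 0) => j jk.
by have := fa (Ordinal jk); rewrite mxE (tnth_nth 0).
Qed.

End Reach.

(** * Well-definedness, construction and uniqueness of the multiplicative map *)

Lemma act_pw_eq (R : GRData) (HR : is_GammaRing R) (r : car R 2) (Hr : fdl r)
    k n m (f : ptmap (2 ^ n) k) (g : ptmap (2 ^ m) k) :
  hz_act f (pm1 n) = hz_act g (pm1 m) -> gr_act f (pw r n) = gr_act g (pw r m).
Proof.
case: Hr => [[r1 _] _ Hperm Hpair].
(* The common exponent is [(maxn n m).+1] rather than [maxn n m], because conditions (3) and (4) are
   stated for positive exponents. *)
have [cn Hn] := pw_lower (leqW (leq_maxl n m)).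
have [cm Hm] := pw_lower (leqW (leq_maxr n m)).
rewrite -[pm1 n](Hn HZ HZ_GammaRing _ hz_pm_collapse).
rewrite -[pm1 m](Hm HZ HZ_GammaRing _ hz_pm_collapse).
rewrite -(Hn R HR r r1) -(Hm R HR r r1).
move: (maxn n m).+1 (ltn0Sn (maxn n m)) cn cm {Hn Hm} => N N0 cn cm.
rewrite -[gr_act cn (pw hz_pm N)]/(hz_act cn (pm1 N)).
rewrite -[gr_act cm (pw hz_pm N)]/(hz_act cm (pm1 N)).
rewrite -!hz_act_comp -!(gr_act_comp HR) => fg.
apply: (@act_eq_weight R HR _ inAp).
- by move=> s s0 sA; apply: Hperm.
- move=> i j i0 ij jN cij; apply: Hpair => //.
  by rewrite -ltnS prednK ?expn_gt0 // (leq_trans _ jN) // (leq_ltn_trans i0).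
move=> l lk; have := congr1 (fun s : k.-tuple int => nth 0%R s l) fg.
rewrite !nth_hz_act //.
by under eq_bigr => i _ do rewrite nth_pm1 //;
  under [RHS]eq_bigr => i _ do rewrite nth_pm1 //.
Qed.

Theorem theorem3p4 (R : GRData) (HR : is_GammaRing R) (r : car R 2) (Hr : fdl r) :
  exists phi : forall n, car HZ n -> car R n,
    [/\ is_mult phi,
        (forall n, phi (2 ^ n)%N (pm1 n) = pw r n),
        (forall k n (f : ptmap (2 ^ n) k) (a : car HZ k),
            gr_act f (pm1 n) = a -> phi k a = gr_act f (pw r n)) &
        (forall psi : forall n, car HZ n -> car R n,
            is_mult psi -> (forall n, psi (2 ^ n)%N (pm1 n) = pw r n) ->
            forall n (x : car HZ n), psi n x = phi n x)].
Proof.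
(* Packing [n] and [f] into one choice type with a decidable equation lets [xchoose] pick a
   presentation of each tuple; by [act_pw_eq] the value does not depend on the pick. *)
have reach k (a : k.-tuple int) :
    exists p : {n & ptmap (2 ^ n) k}, hz_act (tagged p) (pm1 (tag p)) == a.
  by have [n [f <-]] := pm1_reach a; exists (Tagged (fun n => ptmap (2 ^ n) k) f).
pose phi k (a : car HZ k) : car R k :=
  gr_act (tagged (xchoose (reach k a))) (pw r (tag (xchoose (reach k a)))).
have phiE k n (f : ptmap (2 ^ n) k) (a : car HZ k) :
    gr_act f (pm1 n) = a -> phi k a = gr_act f (pw r n).
  move=> fa; apply: act_pw_eq => //; rewrite (eqP (xchooseP (reach k a))).
  exact: esym fa.
have phi_pm1 n : phi _ (pm1 n) = pw r n.
  by rewrite (phiE _ n (ptid _)) ?(gr_act_id HR) // (gr_act_id HZ_GammaRing).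
exists phi; split=> //; last first.
  (* Naturality forces the value at f(±1_n), and every tuple has this form. *)
  move=> psi [psi_act _ _ _] psi_pm1 k a; have [n [f fa]] := pm1_reach a.
  by rewrite (phiE _ _ f a fa) -fa -psi_pm1; apply: psi_act.
split.
- move=> n m g a; have [N [f fa]] := pm1_reach a.
  rewrite (phiE _ _ f a fa) -gr_act_comp //; apply: phiE.
  by rewrite (gr_act_comp HZ_GammaRing) -fa.
- move=> n; rewrite (phiE _ 0 (mkpt 1 n (fun=> 0))) ?(gr_act_zero HR) //.
  exact: (gr_act_zero HZ_GammaRing).
- exact: (phi_pm1 0).
(* If [f] and [g] present [a] and [b], then their smash product, after the relabelling of [pw_add],
   presents the product; the same computation is made in [HZ] and in [R]. *)
- move=> n m a b; have [N [f fa]] := pm1_reach a; have [M [g gb]] := pm1_reach b.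
  rewrite (phiE _ _ f a fa) (phiE _ _ g b gb) gr_mul_act // pw_add // -gr_act_comp //.
  apply: phiE; rewrite (gr_act_comp HZ_GammaRing) -(pw_add HZ_GammaRing).
  by rewrite -(gr_mul_act HZ_GammaRing) -fa -gb.
Qed.
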